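(* For every integer $m \ge 2$ the following upper bounds hold: $d(m,2m+3)\le 17$, $d(m,2m+4)\le 21$, $d(m,2m+5)\le 158$, $d(m,2m+6)\le 158$, $d(m,2m+7)\le 252$, $d(m,2m+8)\le 297$, $d(m,2m+9)\le 1073$, $d(m,2m+10)\le 1273$, $d(m,2m+11)\le 1888$, $d(m,2m+12)\le 2189$, $d(m,2m+13)\le 3224$, $d(m,2m+14)\le 3696$, $d(m,2m+15)\le 5141$, $d(m,2m+16)\le 6586$, $d(m,2m+17)\le 11692$, $d(m,2m+18)\le 12296$, $d(m,2m+19)\le 16027$, $d(m,2m+20)\le 19758$, $d(m,2m+21)\le 32054$, $d(m,2m+22)\le 39516$, $d(m,2m+23)\le 254364$, $d(m,2m+24)\le 276612$, $d(m,2m+25)\le 338169$, $d(m,2m+26)\le 399726$, $d(m,2m+27)\le 1614202$, $d(m,2m+28)\le 1725442$, $d(m,2m+29)\le 2033227$, $d(m,2m+30)\le 2067824$, $d(m,2m+31)\le 8132908$, $d(m,2m+32)\le 8271296$, $d(m,2m+33)\le 26431951$, $d(m,2m+34)\le 26881712$, $d(m,2m+35)\le 105727804$, $d(m,2m+36)\le 107526848$.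
   Context: An integral point set in $\mathbb{R}^m$ is a finite set $\mathcal{P}$ of points of the $m$-dimensional Euclidean space $\mathbb{R}^m$ such that the Euclidean distance between any two points of $\mathcal{P}$ is an integer and $\mathcal{P}$ is not contained in an $(m-1)$-dimensional (affine) hyperplane. Its diameter is $\operatorname{diam}(\mathcal{P}) = \max_{P_1, P_2 \in \mathcal{P}} |P_1P_2|$. The function $d(m,n)$ is the minimal possible diameter of an integral point set of $n$ points in $\mathbb{R}^m$. *)

(* Defs.v *)
From mathcomp Require Import all_boot all_order all_algebra finmap.
From mathcomp Require Import mathcomp_extra boolp classical_sets reals.
From mathcomp Require Import constructive_ereal ereal.

Set Implicit Arguments.
Unset Strict Implicit.
Unset Printing Implicit Defensive.

Import Order.TTheory GRing.Theory Num.Theory.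

Local Open Scope fset_scope.
Local Open Scope classical_set_scope.
Local Open Scope ring_scope.

(* The norm carried by 'rV[R]_m in MathComp-Analysis is the sup norm, hence an
   explicit Euclidean distance. *)
Definition euclidean_dist (R : realType) (m : nat) (x y : 'rV[R]_m) : R :=
  Num.sqrt (\sum_(i < m) (x 0 i - y 0 i) ^+ 2).

Definition affine_subspace (R : realType) (m : nat) (p : 'rV[R]_m)
    (U : {vspace 'rV[R]_m}) : set 'rV[R]_m :=
  [set x | x - p \in U].

Definition is_hyperplane (R : realType) (m : nat) (H : set 'rV[R]_m) : Prop :=
  exists (p : 'rV[R]_m) (U : {vspace 'rV[R]_m}),
    (\dim U).+1 = m /\ H = affine_subspace p U.

Definition integral_point_set (R : realType) (m : nat)
    (P : {fset 'rV[R]_m}) : Prop :=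
  (forall x y, x \in P -> y \in P -> euclidean_dist x y \is a Num.int) /\
  ~ (exists H : set 'rV[R]_m, is_hyperplane H /\ [set` P] `<=` H).

(* Distances are nonnegative, so the default value 0 of the maximum only
   matters for the empty set. *)
Definition diam (R : realType) (m : nat) (P : {fset 'rV[R]_m}) : R :=
  \big[Num.max/0]_(x <- P) \big[Num.max/0]_(y <- P) euclidean_dist x y.

(* The minimal diameter d(m, n), as an infimum in the extended reals: it is
   +oo when no integral point set of n points exists in R^m, and is otherwise
   attained (min_diam_attained). *)
Definition min_diam (R : realType) (m n : nat) : \bar R :=
  ereal_inf [set (diam P)%:E |
    P in [set P : {fset 'rV[R]_m} | integral_point_set P /\ #|` P| = n]].

Lemma diam_nat (R : realType) (m : nat) (P : {fset 'rV[R]_m}) :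
  integral_point_set P -> exists k : nat, diam P = k%:R.
Proof.
move=> [Pint _].
suff : diam P \is a Num.nat by move/natrP=> [k ->]; exists k.
have max_nat (x y : R) : x \is a Num.nat -> y \is a Num.nat ->
    Num.max x y \is a Num.nat by rewrite maxEle; case: ifP.
rewrite /diam big_seq; apply: (big_ind (fun z => z \is a Num.nat)) => // x xP.
rewrite big_seq; apply: (big_ind (fun z => z \is a Num.nat)) => // y yP.
by rewrite natrEint (Pint x y xP yP) sqrtr_ge0.
Qed.

Lemma min_diam_attained (R : realType) (m n : nat) :
  (exists P : {fset 'rV[R]_m}, integral_point_set P /\ #|` P| = n) ->
  exists P : {fset 'rV[R]_m},
    [/\ integral_point_set P, #|` P| = n, min_diam R m n = (diam P)%:E &
        forall Q : {fset 'rV[R]_m},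
          integral_point_set Q -> #|` Q| = n -> diam P <= diam Q].
Proof.
move=> [P0 [P0i P0n]].
pose A k := `[< exists P : {fset 'rV[R]_m},
  [/\ integral_point_set P, #|` P| = n & diam P = k%:R] >].
have exA : exists k, A k.
  by have [k dk] := diam_nat P0i; exists k; apply/asboolP; exists P0.
case: (ex_minnP exA) => k /asboolP[P [Pi Pn dP]] kmin.
have Pmin (Q : {fset 'rV[R]_m}) :
    integral_point_set Q -> #|` Q| = n -> diam P <= diam Q.
  move=> Qi Qn; have [l dl] := diam_nat Qi.
  by rewrite dP dl ler_nat; apply: kmin; apply/asboolP; exists Q.
exists P; split => //; apply/eqP; rewrite eq_le; apply/andP; split.
  by apply: ereal_inf_lbound; exists P.
by apply: le_ereal_inf_tmp => _ [Q [Qi Qn] <-]; rewrite lee_fin; exact: Pmin.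
Qed.

(* Main.v *)
(* The point set is the union of a set of points on a line L and of two parallel
   copies, over the points -h and h of L, of a simplex of m - 1 vertices with
   edge a, all of whose vertices have the same squared distance r2 to L.  All
   distances from a point of L to a copy are then equal, so that whether all the
   distances are integers does not depend on m: only 2 h, a,
   sqrt ((2 h)^2 + a^2), the distances on L and the sqrt ((t +- h)^2 + r2), for t
   on L, matter.  Such a simplex exists in the orthogonal of L, in every
   dimension, as soon as a^2 <= 2 r2.

   For given r2 and h, the points t with both (t + h)^2 + r2 and (t - h)^2 + r2
   squares are the rational points of an elliptic curve, and scaling makes
   finitely many of them integral.  The numerical data come from a computer
   search. *)

From Stdlib Require Import ZArith.
Require Import Defs.
From mathcomp Require Import all_boot all_order all_algebra finmap.
From mathcomp Require Import mathcomp_extra boolp classical_sets reals.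
From mathcomp Require Import constructive_ereal ereal.
From mathcomp Require Import ssrZ zify lra ring.

Set Implicit Arguments.
Unset Strict Implicit.
Unset Printing Implicit Defensive.

Import Order.TTheory GRing.Theory Num.Theory.
Local Delimit Scope Z_scope with Z.
Local Open Scope fset_scope.
Local Open Scope classical_set_scope.
Local Open Scope ring_scope.

(** * Squared Euclidean norm *)

Definition sqnorm (R : realType) n (x : 'rV[R]_n) : R :=
  \sum_(i < n) x 0 i ^+ 2.

Lemma euclidean_distE (R : realType) n (x y : 'rV[R]_n) :
  euclidean_dist x y = Num.sqrt (sqnorm (x - y)).
Proof. by congr Num.sqrt; apply: eq_bigr => i _; rewrite !mxE. Qed.

Lemma sqnormN (R : realType) n (x : 'rV[R]_n) : sqnorm (- x) = sqnorm x.
Proof. by apply: eq_bigr => i _; rewrite mxE sqrrN. Qed.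

Lemma sqnorm0 (R : realType) n : sqnorm (0 : 'rV[R]_n) = 0.
Proof. by rewrite /sqnorm big1 // => i _; rewrite mxE expr0n. Qed.

Lemma sqnorm_row_mx (R : realType) p q (x : 'rV[R]_p) (y : 'rV[R]_q) :
  sqnorm (row_mx x y) = sqnorm x + sqnorm y.
Proof.
rewrite /sqnorm big_split_ord; congr (_ + _); apply: eq_bigr => i _.
  by rewrite row_mxEl.
by rewrite row_mxEr.
Qed.

(** * Equidistant bases of constant norm *)

Lemma sum_indicator (R : realType) k (i : 'I_k) : \sum_(j < k) (j == i)%:R = 1 :> R.
Proof. by rewrite (bigD1 i) //= eqxx big1 ?addr0 // => j /negbTE ->. Qed.

(** The vectors [al *: e_i] already have mutual distance [a]. Translating them along the all-ones
    vector keeps these distances and raises the common squared norm from its value [a ^+ 2 / 2] to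
    [r2]. *)
Lemma equidistant_basis (R : realType) k (a r2 : R) :
  (0 < k)%N -> 0 < a -> a ^+ 2 <= 2 * r2 ->
  exists v : 'I_k -> 'rV[R]_k,
    [/\ forall i, sqnorm (v i) = r2,
        forall i j, i != j -> sqnorm (v i - v j) = a ^+ 2 &
        forall U : {vspace 'rV[R]_k}, (forall i, v i \in U) -> U = fullv].
Proof.
move=> k0 a0 ar; have kR : 0 < k%:R :> R by rewrite ltr0n.
(* [ga] is the common value of the coordinates of the sum of the vectors; [a ^+ 2 <= 2 * r2] makes
   it real and positive. *)
pose al := Num.sqrt (a ^+ 2 / 2); pose ga := Num.sqrt (al ^+ 2 + k%:R * (r2 - al ^+ 2)).
pose be := (ga - al) / k%:R.
have al2 : al ^+ 2 = a ^+ 2 / 2.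
  by rewrite sqr_sqrtr // divr_ge0 ?ler0n // ltW // exprn_gt0.
have al0 : 0 < al by rewrite sqrtr_gt0 divr_gt0 ?exprn_gt0 ?ltr0n.
have D0 : 0 < al ^+ 2 + k%:R * (r2 - al ^+ 2).
  apply: ltr_pwDl; first by rewrite exprn_gt0.
  by apply: mulr_ge0; [exact: ltW | rewrite al2; lra].
have ga2 : ga ^+ 2 = al ^+ 2 + k%:R * (r2 - al ^+ 2) by rewrite sqr_sqrtr // ltW.
have ga0 : 0 < ga by rewrite sqrtr_gt0.
have gaE : al + k%:R * be = ga by rewrite /be; field; rewrite gt_eqF.
pose v i : 'rV[R]_k := al *: delta_mx 0 i + const_mx be.
exists v; split => [i|i j nij|U vU].
- have -> : sqnorm (v i)
      = \sum_(l < k) ((al ^+ 2 + 2 * al * be) * (l == i)%:R + be ^+ 2).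
    by apply: eq_bigr => l _; rewrite !mxE; case: (l == i) => /=; ring.
  rewrite big_split /= -mulr_sumr sum_indicator sumr_const card_ord -mulr_natl.
  (* Multiplication by k completes the square: k times the squared norm is (al + k be)^2 + (k - 1)
     al^2. *)
  apply: (mulfI (lt0r_neq0 kR)).
  have := ga2; rewrite -{1}gaE => E; rewrite mulr1.
  have -> : k%:R * r2 = (al + k%:R * be) ^+ 2 - al ^+ 2 + k%:R * al ^+ 2.
    by rewrite E; ring.
  ring.
- have -> : sqnorm (v i - v j)
      = \sum_(l < k) (al ^+ 2 * ((l == i)%:R + (l == j)%:R)).
    apply: eq_bigr => l _; rewrite !mxE /=.
    case: (eqVneq l i) => [->|_]; first by rewrite (negbTE nij) /=; ring.
    by case: (l == j) => /=; ring.
  by rewrite -mulr_sumr big_split /= !sum_indicator al2; field.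
(* Since [ga] is nonzero, the sum of the vectors spans the all-ones direction; subtracting it
   recovers the canonical basis. *)
have oneU : const_mx 1 \in U.
  have : ga^-1 *: (\sum_i v i) \in U by rewrite memvZ // memv_suml.
  rewrite (_ : _ *: _ = const_mx 1) //; apply/rowP => l; rewrite !mxE summxE.
  rewrite (eq_bigr (fun i => al * (i == l)%:R + be)); last first.
    by move=> i _; rewrite !mxE /= eq_sym.
  rewrite big_split /= -mulr_sumr sum_indicator sumr_const card_ord -mulr_natl.
  by rewrite mulr1 gaE mulVf ?gt_eqF.
have deltaU i : delta_mx 0 i \in U.
  rewrite (_ : delta_mx 0 i = al^-1 *: (v i - be *: const_mx 1)).
    by rewrite memvZ // memvB // memvZ.
  by apply/rowP => l; rewrite !mxE; field; rewrite gt_eqF.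
apply/eqP; rewrite eqEsubv subvf /=; apply/subvP => x _.
by rewrite [x]row_sum_delta memv_suml // => i _; rewrite memvZ.
Qed.

(** * Upper bounds from explicit point sets *)

Lemma min_diam_le (R : realType) (m : nat) (s : seq 'rV[R]_m) (N : R) :
  uniq s -> 0 <= N ->
  (forall x y, x \in s -> y \in s ->
     euclidean_dist x y \is a Num.int /\ euclidean_dist x y <= N) ->
  ~ (exists H, is_hyperplane H /\ (forall x, x \in s -> H x)) ->
  (min_diam R m (size s) <= N%:E)%E.
Proof.
move=> us N0 dist_s nH; pose P := [fset x in s].
have PE x : (x \in P) = (x \in s) by rewrite inE.
apply: (@le_trans _ _ (diam P)%:E).
  apply: ereal_inf_lbound; exists P => //; split; last by rewrite card_fseq undup_id.
  split => [x y|[H [hH sH]]]; first by rewrite !PE => xs /(dist_s x _ xs) [].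
  by apply: nH; exists H; split => // x; rewrite -PE => xP; apply: sH.
(* [0 <= N] takes care of the default value 0 of both maxima. *)
rewrite lee_fin /diam big_seq; apply: bigmax_le => // x; rewrite PE => xs.
by rewrite big_seq; apply: bigmax_le => // y; rewrite PE => /(dist_s x _ xs) [].
Qed.

(** * A line, its orthogonal, and two parallel simplices *)

Definition line_point (R : realType) k (t : R) (v : 'rV[R]_k) : 'rV[R]_(1 + k) :=
  row_mx (const_mx t) v.

Lemma euclidean_dist_line_point (R : realType) k (t t' : R) (v w : 'rV[R]_k) :
  euclidean_dist (line_point t v) (line_point t' w)
    = Num.sqrt ((t - t') ^+ 2 + sqnorm (v - w)).
Proof.
rewrite euclidean_distE /line_point opp_row_mx add_row_mx sqnorm_row_mx.
by rewrite /sqnorm big_ord1 !mxE.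
Qed.

Definition int_bounded (R : realType) (N x : R) := x \is a Num.int /\ x <= N.

(** Two points of the line put its direction into the direction space of [H]. Modulo the line, one
    copy of the simplex then gives all the [v i], hence the whole orthogonal, so that this space has
    full dimension. *)
Lemma line_prism_not_in_hyperplane (R : realType) k (v : 'I_k -> 'rV[R]_k)
    (h t t' : R) (H : set 'rV[R]_(1 + k)) :
  (forall U : {vspace 'rV[R]_k}, (forall i, v i \in U) -> U = fullv) ->
  t != t' -> is_hyperplane H ->
  H (line_point t 0) -> H (line_point t' 0) ->
  (forall i, H (line_point h (v i))) -> False.
Proof.
move=> vfull tt' [p [U [dimU ->]]]; rewrite /affine_subspace /= => tU t'U vU.
have diffU x y : x - p \in U -> y - p \in U -> x - y \in U.
  by move=> xU yU; rewrite -[x - y](subrKA p) -(opprB y p) memvB.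
have e0U : row_mx (const_mx 1) 0 \in U.
  rewrite (_ : row_mx _ _ = (t - t')^-1 *: (line_point t 0 - line_point t' 0)).
    by rewrite memvZ // diffU.
  rewrite /line_point opp_row_mx add_row_mx subrr scale_row_mx scaler0.
  by congr row_mx; apply/rowP => i; rewrite !mxE mulVf // subr_eq0.
have fE (w : 'rV[R]_k) : linfun (mulmxr (row_mx (0 : 'M_(k, 1)) 1%:M)) w = row_mx 0 w.
  by rewrite lfunE /= mul_mx_row mulmx0 mulmx1.
(* The linear map embeds the orthogonal of the line, so [vfull] applies to the preimage of [U]. *)
have preimU : (linfun (mulmxr (row_mx (0 : 'M_(k, 1)) 1%:M)) @^-1: U)%VS = fullv.
  apply: vfull => i; rewrite -memv_preim fE.
  rewrite (_ : row_mx _ _ = (line_point h (v i) - line_point t 0)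
             - (h - t) *: row_mx (const_mx 1) 0).
    by rewrite memvB ?memvZ // diffU.
  rewrite /line_point scale_row_mx !opp_row_mx !add_row_mx scaler0 !subr0.
  by congr row_mx; apply/rowP => l; rewrite !mxE; ring.
have : U = fullv.
  apply/eqP; rewrite eqEsubv subvf /=; apply/subvP => x _.
  rewrite -[x]hsubmxK (_ : row_mx _ _ = x 0 (lshift k 0) *: row_mx (const_mx 1) 0
            + linfun (mulmxr (row_mx (0 : 'M_(k, 1)) 1%:M)) (rsubmx x)).
    by rewrite memvD ?memvZ // memv_preim preimU memvf.
  rewrite fE scale_row_mx add_row_mx scaler0 add0r addr0; congr row_mx.
  by apply/rowP => i; rewrite !mxE !ord1 mulr1.
move=> Ufull; move: dimU; rewrite Ufull dimvf /dim /= mul1n => E.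
by move: (ltnn (1 + k)); rewrite -{2}E leqnn.
Qed.

Lemma min_diam_line_prism (R : realType) (m : nat) (ts : seq R) (h a r2 N : R) :
  (2 <= m)%N -> uniq ts -> (2 <= size ts)%N ->
  0 < h -> 0 < a -> a ^+ 2 <= 2 * r2 ->
  {in ts &, forall t t', int_bounded N `|t - t'|} ->
  {in ts, forall t, forall b : bool,
    int_bounded N (Num.sqrt ((t - (-1) ^+ b * h) ^+ 2 + r2))} ->
  int_bounded N a -> int_bounded N (2 * h) ->
  int_bounded N (Num.sqrt ((2 * h) ^+ 2 + a ^+ 2)) ->
  (min_diam R m (size ts + 2 * m.-1) <= N%:E)%E.
Proof.
(* Here [k] is m - 1, the dimension of the orthogonal of the line and the number of vertices of each
   copy. *)
case: m => [|[|k0]] // _; set k := k0.+1 => uts ts2 h0 a0 ar dts dtv da dh dha.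
have [v [vn vd vfull]] := equidistant_basis (ltn0Sn k0) a0 ar.
have N0 : 0 <= N by case: da => _; apply: le_trans; exact: ltW.
have r20 : 0 < r2.
  have := exprn_gt0 2 a0; lra.
(* A nonzero [v i] keeps the apexes off the line. *)
have v0 i : v i != 0.
  by apply/eqP => vi; have := vn i; rewrite vi sqnorm0 => E; move: r20; rewrite -E ltxx.
have vinj : injective v.
  move=> i j vij; apply/eqP/negPn/negP => /vd.
  by rewrite vij subrr sqnorm0 => /esym /eqP; rewrite sqrf_eq0 gt_eqF.
have lpI t t' w w' : line_point t w = line_point t' w' -> t = t' /\ w = w'.
  by move=> /eq_row_mx [/rowP /(_ 0)]; rewrite !mxE.
pose apex (c : bool * 'I_k) := line_point ((-1) ^+ c.1 * h) (v c.2).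
pose s := [seq line_point t 0 | t <- ts] ++ [seq apex c | c <- enum {: bool * 'I_k}].
have -> : (size ts + 2 * k = size s)%N.
  by rewrite size_cat 2!size_map -cardT card_prod card_bool card_ord.
have sgnI (b c : bool) : (-1) ^+ b * h = (-1) ^+ c * h -> b = c.
  by case: b c => [] [] //=; rewrite ?expr0 ?expr1; lra.
apply: min_diam_le => //.
- rewrite cat_uniq map_inj_uniq ?uts /=; last by move=> t t' /lpI [].
  rewrite map_inj_uniq ?enum_uniq ?andbT; last first.
    by move=> [b i] [c j] /lpI /= [/sgnI -> /vinj ->].
  apply/hasPn => _ /mapP [c _ ->]; apply/negP => /mapP [t _ /lpI [_ /eqP]].
  by rewrite (negbTE (v0 _)).
- have sym x y : euclidean_dist x y = euclidean_dist y x.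
    by rewrite !euclidean_distE -opprB sqnormN.
  have dta t c : t \in ts ->
      int_bounded N (euclidean_dist (line_point t 0) (apex c)).
    by move=> tts; rewrite euclidean_dist_line_point sub0r sqnormN vn; apply: dtv.
  move=> x y; rewrite !mem_cat => /orP [] /mapP [t tts ->] /orP [] /mapP [t' t'ts ->].
  + rewrite euclidean_dist_line_point subrr sqnorm0 addr0 sqrtr_sqr.
    exact: dts.
  + exact: dta.
  + rewrite sym; exact: dta.
  rewrite euclidean_dist_line_point; case: t t' {tts t'ts} => [b i] [c j] /=.
  (* Two apexes are at distance 0, [2 * h], [a] or sqrt ((2 h)^2 + a^2), according to whether they
     share the copy and the vertex. *)
  have -> : ((-1) ^+ b * h - (-1) ^+ c * h) ^+ 2 = (b (+) c)%:R * (2 * h) ^+ 2.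
    by case: b c => [] [] /=; ring.
  have [<-|/vd ->] := eqVneq i j.
    rewrite subrr sqnorm0 addr0; case: (b (+) c); last first.
      by rewrite mul0r sqrtr0; split.
    by rewrite mul1r sqrtr_sqr ger0_norm // mulr_ge0 // ltW.
  case: (b (+) c); rewrite ?mul1r ?mul0r ?add0r //.
  by rewrite sqrtr_sqr ger0_norm // ltW.
case: ts {dts dtv} uts ts2 @s => [|t [|t' ts]] // uts _ s [H [hH sH]].
have tt' : t != t' by case/andP: uts; rewrite inE negb_or => /andP [].
apply: (line_prism_not_in_hyperplane (h := h) vfull tt' hH).
- by apply: sH; rewrite mem_cat; apply/orP; left; apply/mapP; exists t; rewrite ?mem_head.
- apply: sH; rewrite mem_cat; apply/orP; left; apply/mapP; exists t' => //.
  by rewrite !inE eqxx orbT.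
move=> i; apply: sH; rewrite mem_cat; apply/orP; right; apply/mapP.
by exists (false, i); rewrite ?mem_enum // /apex expr0 mul1r.
Qed.

(** * Reduction to a computation on binary integers *)

Definition Z2R (R : realType) (z : Z) : R := (int_of_Z z)%:~R.

Lemma Z2R_rmorph (R : realType) :
  exists f : {rmorphism Z -> R}, forall z, Z2R R z = f z.
Proof. by exists (intr \o int_of_Z : {rmorphism Z -> R}). Qed.

Lemma Z2R_le (R : realType) (x y : Z) : (x <=? y)%Z -> Z2R R x <= Z2R R y.
Proof. by move=> xy; rewrite ler_int; lia. Qed.

Lemma Z2R_lt (R : realType) (x y : Z) : (x <? y)%Z -> Z2R R x < Z2R R y.
Proof. by move=> xy; rewrite ltr_int; lia. Qed.

Lemma Z2RD (R : realType) (x y : Z) : Z2R R (x + y)%Z = Z2R R x + Z2R R y.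
Proof. by have [f fE] := Z2R_rmorph R; rewrite !fE -rmorphD. Qed.

Lemma Z2RB (R : realType) (x y : Z) : Z2R R (x - y)%Z = Z2R R x - Z2R R y.
Proof. by have [f fE] := Z2R_rmorph R; rewrite !fE -rmorphB. Qed.

Lemma Z2RM (R : realType) (x y : Z) : Z2R R (x * y)%Z = Z2R R x * Z2R R y.
Proof. by have [f fE] := Z2R_rmorph R; rewrite !fE -rmorphM. Qed.

Lemma Z2R_of_nat (R : realType) (n : nat) : Z2R R (Z.of_nat n) = n%:R.
Proof. by rewrite /Z2R (_ : int_of_Z (Z.of_nat n) = n) //; lia. Qed.

(** Coordinates on the line are halves of integers, so squared distances are quarters. The equality
    test excludes any rounding in [q / 4] and in [Z.sqrt]. *)
Definition quarter_square (M q : Z) : bool :=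
  let s := Z.sqrt (q / 4) in ((4 * (s * s) =? q) && (s <=? M))%Z.

Lemma quarter_squareP (R : realType) (M q : Z) :
  quarter_square M q -> int_bounded (Z2R R M) (Num.sqrt (Z2R R q / 4)).
Proof.
rewrite /quarter_square; have := Z.sqrt_nonneg (q / 4).
move: (Z.sqrt _) => s s0 /andP [/Z.eqb_eq <- sM].
have s0R : 0 <= Z2R R s by apply: (@Z2R_le _ 0); apply/Z.leb_le.
rewrite !Z2RM (_ : Z2R R 4 = 4) // (_ : _ / 4 = Z2R R s ^+ 2); last by field.
by rewrite sqrtr_sqr ger0_norm //; split; [exact: intr_int | exact: Z2R_le].
Qed.

(* The apex vectors have squared norm D / 4 and sit over the points -b / 2 and
   b / 2 of the line; the points of the line are the halves of the elements of
   [config_points] and of their opposites, without the first one in the odd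
   case. *)
Record line_config := LineConfig {
  config_D : Z;
  config_b : Z;
  config_a : Z;
  config_points : seq Z }.

(** The lists given below are decreasing, so the odd case omits an extreme point of the line. *)
Definition config_line (C : line_config) (odd_card : bool) : seq Z :=
  drop odd_card (config_points C ++ [seq (- v)%Z | v <- config_points C]).

(** With 2 (m - 1) apexes, a total of 2 m + c points leaves c + 2 for the line. The test of 2 a^2
    against D is a^2 <= 2 r2 for r2 = D / 4. *)
Definition valid_config (C : line_config) (odd_card : bool) (c : nat) (M : Z) :
    bool :=
  let: LineConfig D b a _ := C in
  let vs := config_line C odd_card in
  [&& uniq vs, size vs == c.+2, (0 <? b)%Z, (0 <? a)%Z & [&& (2 * (a * a) <=? D)%Z,
    all (fun v => all (fun w => quarter_square M ((v - w) * (v - w))) vs) vs,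
    all (fun v => quarter_square M ((v - b) * (v - b) + D)
               && quarter_square M ((v + b) * (v + b) + D)) vs &
    [&& quarter_square M (4 * (a * a)), quarter_square M (4 * (b * b)) &
        quarter_square M (4 * (b * b + a * a))]]].

Lemma min_diam_config (R : realType) (m : nat) (C : line_config)
    (odd_card : bool) (c N : nat) :
  (2 <= m)%N -> valid_config C odd_card c (Z.of_nat N) ->
  (min_diam R m (2 * m + c) <= N%:R%:E)%E.
Proof.
case: C => D b a h m2; rewrite /valid_config; set C := LineConfig D b a h.
move: (config_line C odd_card) => vs.
case/and5P=> uvs /eqP szvs b0 a0 /and4P [aD /allP dvs /allP dva /and3P [da db dc]].
pose z := Z2R R; pose ts : seq R := [seq z v / 2 | v <- vs].
have z0 : z 0%Z = 0 by [].
have zinj : injective z.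
  by move=> x y; rewrite /z /Z2R => /intr_inj; lia.
have b0R : 0 < z b by rewrite -z0; exact: Z2R_lt.
have a0R : 0 < z a by rewrite -z0; exact: Z2R_lt.
have z2 : z 2%Z = 2 by [].
have z4 : z 4%Z = 4 by [].
have sqr_quarter (x : R) : 0 < x -> Num.sqrt (4 * (x * x) / 4) = x.
  move=> x0; rewrite (_ : _ / 4 = x ^+ 2); last by field.
  by rewrite sqrtr_sqr gtr0_norm.
have -> : (2 * m + c = size ts + 2 * m.-1)%N.
  by rewrite size_map szvs; case: m m2 => // m _; rewrite mulnS /=; lia.
rewrite -Z2R_of_nat; apply: (@min_diam_line_prism _ _ ts (z b / 2) (z a) (z D / 4)) => //.
- rewrite map_inj_uniq // => x y /(mulIf _) E; apply/zinj/E.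
  by rewrite invr_eq0 pnatr_eq0.
- by rewrite size_map szvs.
- by rewrite divr_gt0.
- by have := Z2R_le R aD; rewrite !Z2RM -/z z2 expr2; lra.
- move=> _ _ /mapP [v vv ->] /mapP [w ww ->].
  have := quarter_squareP R (allP (dvs v vv) w ww).
  rewrite Z2RM Z2RB -/z (_ : _ / 4 = (z v / 2 - z w / 2) ^+ 2); last by field.
  by rewrite sqrtr_sqr.
- move=> _ /mapP [v vv ->] e; case/andP: (dva v vv) => /(quarter_squareP R) dm.
  move=> /(quarter_squareP R) dp; move: dm dp.
  rewrite !Z2RD !Z2RM !Z2RB !Z2RD -/z.
  (* The sign [true] is the apex over - b / 2, whose distances involve v + b; [false] goes with v -
     b. *)
  case: e => [_|+ _].
    by rewrite (_ : _ / 4 = (z v / 2 - (-1) ^+ true * (z b / 2)) ^+ 2 + z D / 4) //=; field.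
  by rewrite (_ : _ / 4 = (z v / 2 - (-1) ^+ false * (z b / 2)) ^+ 2 + z D / 4) //=; field.
- by have := quarter_squareP R da; rewrite !Z2RM -/z z4 sqr_quarter.
- have := quarter_squareP R db; rewrite !Z2RM -/z z4 sqr_quarter //.
  by rewrite (_ : 2 * (z b / 2) = z b) //; field.
have := quarter_squareP R dc; rewrite !Z2RM Z2RD !Z2RM -/z z4.
by rewrite (_ : _ / 4 = (2 * (z b / 2)) ^+ 2 + z a ^+ 2) //; field.
Qed.

(* The same curve, scaled by k, provides all the configurations from 18 points
   on. *)
Definition curve_config (k a : Z) (vs : seq Z) : line_config :=
  LineConfig (2217600 * (k * k)) (1748 * k) a vs.

(** * Numerical data *)

(** The index counts the points of the even case for m = 2, where there are two apexes. In each
    configuration b and a are the legs of a Pythagorean triangle. *)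
Definition config8 : line_config := LineConfig 315 8 6
  [:: 21; 11; 5]%Z.
Definition config10 : line_config := LineConfig 27027 40 9
  [:: 143; 97; 63; 17]%Z.
Definition config12 : line_config := LineConfig 40320 99 20
  [:: 297; 207; 145; 63; 25]%Z.
Definition config14 : line_config := LineConfig 80640 195 28
  [:: 793; 403; 329; 243; 81; 23]%Z.
Definition config16 : line_config := LineConfig 887040 1105 300
  [:: 2189; 1587; 1269; 763; 623; 529; 339]%Z.
Definition config18 : line_config := curve_config 1 336
  [:: 3696; 2752; 2072; 1798; 1698; 1226; 1152; 200]%Z.
Definition config20 : line_config := curve_config 1 336
  [:: 6586; 3696; 2752; 2072; 1798; 1698; 1226; 1152; 200]%Z.
Definition config22 : line_config := curve_config 3 1008
  [:: 12296; 11088; 8256; 6216; 5394; 5094; 3678; 3456; 1808; 600]%Z.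
Definition config24 : line_config := curve_config 3 1008
  [:: 19758; 12296; 11088; 8256; 6216; 5394; 5094; 3678; 3456; 1808; 600]%Z.
Definition config26 : line_config := curve_config 6 1015
  [:: 39516; 24592; 22176; 17158; 16512; 12432; 10788; 10188; 7356; 6912;
      3616; 1200]%Z.
Definition config28 : line_config := curve_config 42 2710
  [:: 276612; 232116; 172144; 155232; 120106; 115584; 87024; 75516; 71316;
      51492; 48384; 25312; 8400]%Z.
Definition config30 : line_config := curve_config 42 2710
  [:: 399726; 276612; 232116; 172144; 155232; 120106; 115584; 87024; 75516;
      71316; 51492; 48384; 25312; 8400]%Z.
Definition config32 : line_config := curve_config 168 5198
  [:: 1598904; 1106448; 928464; 688576; 620928; 480424; 462336; 348096;
      302064; 285264; 205968; 193536; 123270; 101248; 33600]%Z.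
Definition config34 : line_config := curve_config 210 3206
  [:: 2067824; 1998630; 1383060; 1160580; 860720; 776160; 600530; 577920;
      435120; 377580; 356580; 257460; 241920; 126560; 42000; 22448]%Z.
Definition config36 : line_config := curve_config 840 12824
  [:: 8271296; 7994520; 5532240; 4642320; 3442880; 3104640; 2402120; 2311680;
      1740480; 1510320; 1426320; 1029840; 967680; 616350; 506240; 168000;
      89792]%Z.
Definition config38 : line_config := curve_config 2730 41678
  [:: 26881712; 25982190; 17979780; 15087540; 11189360; 10090080; 7806890;
      7512960; 7389690; 5656560; 4908540; 4635540; 3346980; 3144960; 1645280;
      969360; 546000; 291824]%Z.
Definition config40 : line_config := curve_config 10920 8738
  [:: 107526848; 103928760; 71919120; 60350160; 44757440; 40360320; 31227560;
      30051840; 29558760; 22626240; 19634160; 18542160; 13387920; 12579840;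
      8012550; 6581120; 3877440; 2184000; 1167296]%Z.

(** This reads a large bound in binary, directly from its decimal digits. *)
Lemma Z_of_nat_of_uint (d : Decimal.uint) :
  Z.of_nat (Nat.of_num_uint (Number.UIntDecimal d)) = Z.of_N (N.of_uint d).
Proof. by rewrite /= -common.uint_N_nat; lia. Qed.

(* Literals above 5000 are parsed as [Nat.of_num_uint _] and must not be unfolded
   to unary numbers. *)
Ltac line_bound C odd_card :=
  apply: (@min_diam_config _ _ C odd_card);
    [assumption | rewrite ?Z_of_nat_of_uint; vm_compute; reflexivity].

Local Open Scope ereal_scope.

Theorem mainTheorem3 (R : realType) (m : nat) (hm : (2 <= m)%N) :
  min_diam R m (2 * m + 3)%N <= 17%:R%:E /\
  min_diam R m (2 * m + 4)%N <= 21%:R%:E /\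
  min_diam R m (2 * m + 5)%N <= 158%:R%:E /\
  min_diam R m (2 * m + 6)%N <= 158%:R%:E /\
  min_diam R m (2 * m + 7)%N <= 252%:R%:E /\
  min_diam R m (2 * m + 8)%N <= 297%:R%:E /\
  min_diam R m (2 * m + 9)%N <= 1073%:R%:E /\
  min_diam R m (2 * m + 10)%N <= 1273%:R%:E /\
  min_diam R m (2 * m + 11)%N <= 1888%:R%:E /\
  min_diam R m (2 * m + 12)%N <= 2189%:R%:E /\
  min_diam R m (2 * m + 13)%N <= 3224%:R%:E /\
  min_diam R m (2 * m + 14)%N <= 3696%:R%:E /\
  min_diam R m (2 * m + 15)%N <= 5141%:R%:E /\
  min_diam R m (2 * m + 16)%N <= 6586%:R%:E /\
  min_diam R m (2 * m + 17)%N <= 11692%:R%:E /\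
  min_diam R m (2 * m + 18)%N <= 12296%:R%:E /\
  min_diam R m (2 * m + 19)%N <= 16027%:R%:E /\
  min_diam R m (2 * m + 20)%N <= 19758%:R%:E /\
  min_diam R m (2 * m + 21)%N <= 32054%:R%:E /\
  min_diam R m (2 * m + 22)%N <= 39516%:R%:E /\
  min_diam R m (2 * m + 23)%N <= 254364%:R%:E /\
  min_diam R m (2 * m + 24)%N <= 276612%:R%:E /\
  min_diam R m (2 * m + 25)%N <= 338169%:R%:E /\
  min_diam R m (2 * m + 26)%N <= 399726%:R%:E /\
  min_diam R m (2 * m + 27)%N <= 1614202%:R%:E /\
  min_diam R m (2 * m + 28)%N <= 1725442%:R%:E /\
  min_diam R m (2 * m + 29)%N <= 2033227%:R%:E /\
  min_diam R m (2 * m + 30)%N <= 2067824%:R%:E /\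
  min_diam R m (2 * m + 31)%N <= 8132908%:R%:E /\
  min_diam R m (2 * m + 32)%N <= 8271296%:R%:E /\
  min_diam R m (2 * m + 33)%N <= 26431951%:R%:E /\
  min_diam R m (2 * m + 34)%N <= 26881712%:R%:E /\
  min_diam R m (2 * m + 35)%N <= 105727804%:R%:E /\
  min_diam R m (2 * m + 36)%N <= 107526848%:R%:E.
Proof.
(* Each configuration yields two consecutive bounds, the first with one point of the line
   removed. *)
split; first by line_bound config8 true.
split; first by line_bound config8 false.
split; first by line_bound config10 true.
split; first by line_bound config10 false.
split; first by line_bound config12 true.
split; first by line_bound config12 false.
split; first by line_bound config14 true.
split; first by line_bound config14 false.
split; first by line_bound config16 true.
split; first by line_bound config16 false.
split; first by line_bound config18 true.
split; first by line_bound config18 false.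
split; first by line_bound config20 true.
split; first by line_bound config20 false.
split; first by line_bound config22 true.
split; first by line_bound config22 false.
split; first by line_bound config24 true.
split; first by line_bound config24 false.
split; first by line_bound config26 true.
split; first by line_bound config26 false.
split; first by line_bound config28 true.
split; first by line_bound config28 false.
split; first by line_bound config30 true.
split; first by line_bound config30 false.
split; first by line_bound config32 true.
split; first by line_bound config32 false.
split; first by line_bound config34 true.
split; first by line_bound config34 false.
split; first by line_bound config36 true.
split; first by line_bound config36 false.
split; first by line_bound config38 true.
split; first by line_bound config38 false.
split; first by line_bound config40 true.
by line_bound config40 false.
Qed.
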